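(* Let $k$ be a field, $n\ge 2$, and let $m_0,\ldots,m_n$ be an arithmetic sequence with $m_0\equiv 0\pmod n$ (i.e. $m_0\equiv n \pmod n$). Let $R=k[X_0,\ldots,X_n]$, let $\mathcal P$ be the kernel of $R\to k[t]$, $X_i\mapsto t^{m_i}$, and $k[\Gamma]=R/\mathcal P$. Then $k[\Gamma]$ has a minimal free resolution over $R$ of the form $$0\to R^{n-1}\to R^{(n-2)\binom{n}{n-1}+(n-1)}\to\cdots\to R^{1+\binom n2}\to R\to k[\Gamma]\to 0,$$ whose $s$-th free module has rank $(s-1)\binom{n}{s}+s\binom{n}{s+1}$ for $s\ge 2$. In particular, the Betti numbers are $\beta_0=1$, $\beta_1=1+\binom n2$, and $\beta_s=(s-1)\binom ns+s\binom n{s+1}$ for every $s\in[2,n]$.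
   Context: A sequence of positive integers $m_0,\ldots,m_n$ is called an arithmetic sequence if: (i) $\gcd(m_0,\ldots,m_n)=1$; (ii) $0<m_0<\cdots<m_n$ and $m_i=m_0+id$ for all $i\in[1,n]$ for some integer $d$; (iii) $m_j\notin\sum_{i\neq j}\mathbb N m_i$ for every $j$. *)

(* Defs.v *)
From HB Require Import structures.
From mathcomp Require Import all_boot all_order all_algebra.
From mathcomp Require Import mpoly.

Set Implicit Arguments.
Unset Strict Implicit.
Unset Printing Implicit Defensive.

Import GRing.Theory.
Local Open Scope ring_scope.

Definition arithmetic_seq (n : nat) (m : nat -> nat) : Prop :=
  [/\ (\big[gcdn/0%N]_(i < n.+1) m i = 1)%N,
      (0 < m 0)%N,
      (forall i, (i < n)%N -> (m i < m i.+1)%N),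
      (exists d : int, forall i, (i <= n)%N -> (m i)%:Z = (m 0)%:Z + i%:Z * d)
    & (forall j : 'I_n.+1, ~ exists c : 'I_n.+1 -> nat,
          c j = 0%N /\ (\sum_(i < n.+1) c i * m i)%N = m j)].

Notation Rpoly k n := {mpoly k[n.+1]}.

Definition in_toric_ideal (k : fieldType) (n : nat) (m : nat -> nat)
  (p : Rpoly k n) : Prop :=
  mmap (@polyC k) (fun i : 'I_n.+1 => 'X^(m i)) p = 0.

(* A minimal free resolution of k[Gamma] = R/P over R:
     ... -> F_2 --d 1--> F_1 --d 0--> F_0 --e--> R/P -> 0
   with F_s = R^(b s) (column vectors), d s : F_(s+1) -> F_s given by a
   b s x b (s+1) matrix, and e : F_0 -> R/P given by a row vector of
   representatives in R of the images of the basis vectors.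
   Minimality: all entries of all differentials lie in the homogeneous
   maximal ideal (X_0,...,X_n), i.e. have zero constant coefficient. *)
Definition min_free_resolution (k : fieldType) (n : nat) (m : nat -> nat)
  (b : nat -> nat) (e : 'rV[Rpoly k n]_(b 0%N))
  (d : forall s : nat, 'M[Rpoly k n]_(b s, b s.+1)) : Prop :=
  [/\
      (forall f : Rpoly k n, exists v : 'cV[Rpoly k n]_(b 0%N),
          in_toric_ideal m (f - (e *m v) 0 0)),
      (forall v : 'cV[Rpoly k n]_(b 0%N),
          in_toric_ideal m ((e *m v) 0 0) <->
          exists w : 'cV[Rpoly k n]_(b 1%N), v = d 0%N *m w),
      (forall s (v : 'cV[Rpoly k n]_(b s.+1)),
          d s *m v = 0 <-> exists w : 'cV[Rpoly k n]_(b s.+2), v = d s.+1 *m w)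
    &
      (forall s i j, (d s i j)@_(0%MM) = 0)].

(* Main.v *)
Require Import Defs.
From HB Require Import structures.
From mathcomp Require Import all_boot all_order all_algebra.
From mathcomp Require Import mpoly.
From mathcomp Require Import ring zify.

(* Write [m_i = a n + i delta]. The toric ideal is [J + (f)], where [J] is the
   ideal of the cone over the rational normal curve, generated by the 2x2 minors of the matrix
   with rows [Y = (x_1 .. x_n)] and [X = (x_0 .. x_(n-1))], and
   [f = x_n^a - x_0^(a + delta)] is regular modulo the prime [J]; so a resolution is
   the mapping cone of [f] on the Eagon-Northcott complex, whose [s]-th module has
   rank [s 'C(n, s.+1)].

   The Eagon-Northcott complex is a window of the Koszul complex of the pencil
   [Y - w X] over R[w, 1/w]: a chain of degree [s] is a Laurent polynomial supported
   on [s] consecutive powers of [w]. The boundary of a cycle of this window leaves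
   one term above and one term below it; each is a Koszul boundary, over R[w] and
   over R[1/w] respectively, because both pencils are regular sequences. Subtracting
   them gives an honest Koszul cycle over R[w, 1/w], hence a boundary, whose
   restriction to the next window does the job. The same argument identifies the
   image of the first differential with the set of [g] killed by both
   [x_i |-> w^i x_0] and [x_i |-> w^(n-i) x_n].

   Betti numbers are independent of the minimal resolution since two resolutions are
   homotopy equivalent, and the differentials vanish modulo the variables. *)

Set Implicit Arguments.
Unset Strict Implicit.
Unset Printing Implicit Defensive.

Import GRing.Theory.
Local Open Scope ring_scope.

(** * Mapping cones and the Koszul complex *)

(* A complex is given by the ranks [b] of its modules in positive degrees; its module in
   degree 0 has rank 1. *)
Definition rk (b : nat -> nat) (s : nat) : nat := if s is s'.+1 then b s' else 1%N.

(** This is the rank in degree [s.+1]: the original module there plus the copy shifted up from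
    degree [s]. *)
Definition cone_rk (b : nat -> nat) (s : nat) : nat := (b s + rk b s)%N.

Section Cone.
Variable S : comNzRingType.

Definition diff (b : nat -> nat) := forall s, 'M[S]_(rk b s, rk b s.+1).

Definition is_complex b (d : diff b) := forall s, d s *m d s.+1 = 0.

Definition acyclic b (d : diff b) :=
  forall s (v : 'cV[S]_(rk b s.+1)), d s *m v = 0 -> exists w, v = d s.+1 *m w.

Definition cone_diff b (f : S) (d : diff b) : diff (cone_rk b) := fun s =>
  match s return 'M[S]_(rk (cone_rk b) s, rk (cone_rk b) s.+1) with
  | 0 => row_mx (d 0%N) f%:M
  | s'.+1 => block_mx (d s'.+1) f%:M 0 (- d s')
  end.

Lemma cone_complex b f (d : diff b) : is_complex d -> is_complex (cone_diff f d).
Proof.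
move=> dd [|s] /=.
  rewrite /rk mul_row_block (dd 0%N) mulmx0 add0r mulmxN mul_scalar_mx mul_mx_scalar subrr.
  by rewrite row_mx0.
rewrite /rk mulmx_block (dd s.+1) !(mulmx0, mul0mx) !addr0 !add0r.
rewrite !mulmxN !mulNmx mul_scalar_mx mul_mx_scalar subrr opprK (dd s).
by rewrite block_mx0.
Qed.

(** Long exact sequence of the cone; the second hypothesis says that [f] is a nonzerodivisor on the
    cokernel of [d 0]. *)
Lemma cone_acyclic b f (d : diff b) :
    acyclic d ->
    (forall (g : 'cV[S]_1) a, f *: g = d 0%N *m a -> exists a', g = d 0%N *m a') ->
  acyclic (cone_diff f d).
Proof.
move=> ex reg.
(* A cycle [(v1, v2)] bounds as soon as [v2] does, since [v1 + f *: w2] is then a cycle. In degree 1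
   regularity provides [w2], above it acyclicity of [d]. *)
have key s (v1 : 'cV_(rk b s.+1)) (v2 : 'cV_(rk b s)) w2 :
    d s *m v1 + f *: v2 = 0 -> v2 = d s *m w2 ->
  exists w : 'cV_(rk (cone_rk b) s.+2), col_mx v1 v2 = cone_diff f d s.+1 *m w.
- move=> e1 e2.
  have [w1 ew1] : exists w1, v1 + f *: w2 = d s.+1 *m w1.
    by apply: ex; rewrite mulmxDr -scalemxAr -e2.
  exists (col_mx w1 (- w2)).
  rewrite /rk /= mul_block_col mul0mx add0r mulNmx !mulmxN opprK -e2.
  by rewrite mul_scalar_mx -ew1 addrK.
move=> [|s] v; rewrite -[v]vsubmxK /=.
  rewrite mul_row_col mul_scalar_mx => e.
  have [|a' ea'] := reg (dsubmx v) (- usubmx v).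
    by rewrite mulmxN; apply/eqP; rewrite -addr_eq0 addrC; apply/eqP.
  exact: (key 0%N _ _ _ e ea').
rewrite mul_block_col mul0mx add0r => /eqP.
rewrite col_mx_eq0 mul_scalar_mx mulNmx oppr_eq0 => /andP[/eqP e1 /eqP e2].
by have [w2 ew2] := ex _ _ e2; exact: (key s.+1 _ _ _ e1 ew2).
Qed.

Fixpoint kos_rk (n : nat) : nat -> nat :=
  if n is n'.+1 then cone_rk (kos_rk n') else fun=> 0%N.

Lemma rk_kos n s : rk (kos_rk n) s = 'C(n, s).
Proof.
by elim: n s => [|n IHn] [|s] //; rewrite ?bin0 // binS -!IHn.
Qed.

(** The Koszul complex, built by adjoining one element at a time as a mapping cone. *)
Fixpoint kos (l : nat -> S) (n : nat) : diff (kos_rk n) :=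
  match n return diff (kos_rk n) with
  | 0 => fun s => 0
  | n'.+1 => cone_diff (l n') (kos l n')
  end.

Lemma kos_complex l n : is_complex (kos l n).
Proof. by elim: n => [|n IHn] /=; [move=> s; rewrite mul0mx | exact: cone_complex]. Qed.

Lemma kosD l l' n s : kos (fun i => l i + l' i) n s = kos l n s + kos l' n s.
Proof.
elim: n s => [|n IHn] s /=; first by rewrite addr0.
case: s => [|s] /=; first by rewrite IHn raddfD /= add_row_mx.
by rewrite !IHn raddfD /= opprD add_block_mx addr0.
Qed.

Lemma kosZ c l n s : kos (fun i => c * l i) n s = c *: kos l n s.
Proof.
elim: n s => [|n IHn] s /=; first by rewrite scaler0.
case: s => [|s] /=; first by rewrite IHn scale_row_mx scale_scalar_mx.
by rewrite !IHn scale_block_mx scale_scalar_mx scaler0 scalerN.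
Qed.

Lemma eq_kos l l' n s : (forall i, (i < n)%N -> l i = l' i) -> kos l n s = kos l' n s.
Proof.
elim: n s => [|n IHn] s //= ll'.
have IH t : kos l n t = kos l' n t by apply: IHn => i /ltnW /ll'.
by case: s => [|s] /=; rewrite !IH ll'.
Qed.

(** Polarization: the differential is additive in the sequence, so the cross terms in the square of
    the differential for [l + l'] cancel. *)
Lemma kos_anticomm l l' n s :
  kos l n s *m kos l' n s.+1 = - (kos l' n s *m kos l n s.+1).
Proof.
have /= := kos_complex (fun i => l i + l' i) n s.
rewrite !kosD mulmxDl !mulmxDr !kos_complex addr0 add0r => /eqP.
by rewrite addr_eq0 => /eqP.
Qed.

Definition in_ideal (l : nat -> S) (n : nat) (g : S) :=
  exists c : nat -> S, g = \sum_(i < n) c i * l i.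

Lemma in_idealP l n (g : 'cV[S]_1) :
  in_ideal l n (g 0 0) <-> exists a, g = kos l n 0%N *m a.
Proof.
elim: n g => [|n IHn] g /=.
  split=> [[c]|[a ->]]; last by exists (fun=> 0); rewrite big_ord0 mul0mx mxE.
  by rewrite big_ord0 => g0; exists 0; rewrite mul0mx; apply/matrixP=> i j; rewrite !ord1 mxE.
split=> [[c ec]|[a]].
  have [|a ea] := (IHn (g - (c n * l n)%:M)).1.
    exists c; rewrite !mxE /= ec big_ord_recr /= mulr1n addrK //.
  exists (col_mx a (c n)%:M); rewrite mul_row_col -ea.
  by rewrite -scalar_mxM mulrC subrK.
rewrite -[a]vsubmxK mul_row_col mul_scalar_mx => ->.
have [|c ec] := (IHn (kos l n 0%N *m usubmx a)).2; first by exists (usubmx a).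
exists (fun i => if i == n then dsubmx a 0 0 else c i).
rewrite mxE ec big_ord_recr /= eqxx !mxE mulrC; congr (_ + _).
by apply: eq_bigr => i _; rewrite ltn_eqF.
Qed.

(** For a (weakly) regular sequence, each cone is taken along a nonzerodivisor on the previous
    quotient. *)
Lemma kos_acyclic l n :
    (forall i g, (i < n)%N -> in_ideal l i (l i * g) -> in_ideal l i g) ->
  acyclic (kos l n).
Proof.
elim: n => [|n IHn] reg /=.
  by move=> s v _; exists 0; rewrite mulmx0 /=; apply/matrixP; case.
apply: cone_acyclic => [|g a e]; first by apply: IHn => i g /ltnW; exact: reg.
apply/in_idealP/reg => //.
have -> : l n * g 0 0 = (l n *: g) 0 0 by rewrite mxE.
by apply/in_idealP; exists a.
Qed.

End Cone.

Lemma map_kos (S S' : comNzRingType) (h : {rmorphism S -> S'}) l n s :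
  map_mx h (kos l n s) = kos (h \o l) n s.
Proof.
elim: n s => [|n IHn] s /=; first by rewrite map_mx0.
case: s => [|s] /=.
  by rewrite map_row_mx map_scalar_mx; congr row_mx; exact (IHn 0%N).
rewrite map_block_mx map_mxN map_scalar_mx map_mx0.
by congr block_mx; [exact (IHn s.+1) | congr (- _); exact (IHn s)].
Qed.

(** * Koszul complex of a pencil *)

(** The indeterminate ['X] is the parameter w of the pencil, distinct from the row [X]. *)
Definition pencil (R : comNzRingType) (Y X : nat -> R) (i : nat) : {poly R} :=
  (Y i)%:P - 'X * (X i)%:P.

Section Pencil.
Variables (R : comNzRingType) (n : nat).
Implicit Types X Y : nat -> R.

Local Notation K s := (rk (kos_rk n) s).

Lemma kos_pencil Y X s :
  kos (pencil Y X) n s =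
    map_mx polyC (kos Y n s) - 'X *: map_mx polyC (kos X n s).
Proof.
rewrite !map_kos -kosZ -scaleN1r -kosZ -kosD.
by apply: eq_kos => i _; rewrite /= mulN1r.
Qed.

Lemma coef_mulmx_polyC p q (A : 'M[R]_(p, q)) (W : 'cV[{poly R}]_q) j :
  map_mx (coefp j) (map_mx polyC A *m W) = A *m map_mx (coefp j) W.
Proof.
apply/matrixP=> i c; rewrite !mxE /= coef_sum.
by apply: eq_bigr => h _; rewrite !mxE coefCM.
Qed.

Lemma coef0_kos_pencil Y X s (W : 'cV_(K s.+1)) :
  map_mx (coefp 0) (kos (pencil Y X) n s *m W) =
    kos Y n s *m map_mx (coefp 0) W.
Proof.
rewrite kos_pencil mulmxBl map_mxB coef_mulmx_polyC -scalemxAl.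
suff -> : map_mx (coefp 0) ('X *: (map_mx polyC (kos X n s) *m W)) = 0 by rewrite subr0.
by apply/matrixP=> i c; rewrite !mxE /= coefXM.
Qed.

Lemma coefS_kos_pencil Y X s (W : 'cV_(K s.+1)) j :
  map_mx (coefp j.+1) (kos (pencil Y X) n s *m W) =
    kos Y n s *m map_mx (coefp j.+1) W - kos X n s *m map_mx (coefp j) W.
Proof.
rewrite kos_pencil mulmxBl map_mxB coef_mulmx_polyC -scalemxAl; congr (_ - _).
rewrite -coef_mulmx_polyC.
by apply/matrixP=> i c; rewrite [LHS]mxE [RHS]mxE [in LHS]mxE /= coefXM.
Qed.

(* A bounded sequence [T] stands for the vector [\sum_j w ^ j T_j] over R[w]. *)
Definition bounded m (T : nat -> 'cV[R]_m) :=
  exists N, forall j, (N <= j)%N -> T j = 0.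

Lemma bounded_coef m (W : 'cV[{poly R}]_m) : bounded (fun j => map_mx (coefp j) W).
Proof.
exists (\max_(i < m) size (W i 0%R)) => j le_j; apply/matrixP=> i c.
rewrite !mxE /= nth_default // ord1; apply: leq_trans le_j.
exact: (leq_bigmax i).
Qed.

Definition poly_of_seq m (T : nat -> 'cV[R]_m) N : 'cV[{poly R}]_m :=
  \col_i \poly_(j < N) T j i 0.

Lemma coef_poly_of_seq m (T : nat -> 'cV[R]_m) N j :
  (forall j, (N <= j)%N -> T j = 0) -> map_mx (coefp j) (poly_of_seq T N) = T j.
Proof.
move=> T0; apply/matrixP=> i c; rewrite !mxE /= coef_poly ord1.
by case: ltnP => // /T0 ->; rewrite mxE.
Qed.

Lemma coef_inj m (V W : 'cV[{poly R}]_m) :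
  (forall j, map_mx (coefp j) V = map_mx (coefp j) W) -> V = W.
Proof.
move=> e; apply/matrixP=> i c; apply/polyP=> j.
by have /matrixP/(_ i c) := e j; rewrite !mxE /=.
Qed.

(** Coefficientwise form of: the polynomial with coefficients [T] is a boundary in the Koszul
    complex of [pencil Y X]. *)
Definition pencil_boundary Y X s (T : nat -> 'cV[R]_(K s)) :=
  exists2 T' : nat -> 'cV[R]_(K s.+1), bounded T' &
    T 0%N = kos Y n s *m T' 0%N /\
    forall j, T j.+1 = kos Y n s *m T' j.+1 - kos X n s *m T' j.

Lemma pencil_exact Y X s (T : nat -> 'cV[R]_(K s.+1)) :
    acyclic (kos (pencil Y X) n) -> bounded T ->
    kos Y n s *m T 0%N = 0 ->
    (forall j, kos Y n s *m T j.+1 = kos X n s *m T j) ->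
  pencil_boundary Y X T.
Proof.
move=> ex [N T0] e0 eS.
have [|W eW] := ex s (poly_of_seq T N).
  apply: coef_inj => -[|j]; rewrite ?coef0_kos_pencil ?coefS_kos_pencil.
    by rewrite coef_poly_of_seq // e0 map_mx0.
  by rewrite !coef_poly_of_seq // eS subrr map_mx0.
exists (fun j => map_mx (coefp j) W); first exact: bounded_coef.
split=> [|j]; first by rewrite -(coef0_kos_pencil Y X) -eW coef_poly_of_seq.
by rewrite -coefS_kos_pencil -eW coef_poly_of_seq.
Qed.

Definition const_seq m (P : 'cV[R]_m) (j : nat) : 'cV[R]_m :=
  if j is 0 then P else 0.

Lemma const_seq_exact Y X s (P : 'cV[R]_(K s.+1)) :
    acyclic (kos (pencil Y X) n) ->
    kos Y n s *m P = 0 -> kos X n s *m P = 0 ->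
  pencil_boundary Y X (const_seq P).
Proof.
move=> ex eY eX; apply: pencil_exact => //; first by exists 1%N; case.
by case=> [|j]; rewrite ?eX !mulmx0.
Qed.

Lemma const_seq_ideal Y X (g : 'cV[R]_1) :
  in_ideal (pencil Y X) n (g 0 0)%:P -> @pencil_boundary Y X 0 (const_seq g).
Proof.
move=> gI; have [|W eW] := (in_idealP (pencil Y X) n (map_mx polyC g)).1.
  by rewrite mxE.
exists (fun j => map_mx (coefp j) W); first exact: bounded_coef.
split=> [|j].
  rewrite -(coef0_kos_pencil Y X) -eW; apply/matrixP=> i c.
  by rewrite !mxE /= coefC.
rewrite -coefS_kos_pencil -eW; apply/matrixP=> i c.
by rewrite !mxE /= coefC.
Qed.

(* The sequences [q'] (read backwards), [z] and [p'] are concatenated into one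
   Laurent polynomial, shifted by [M] to have no negative exponents. *)
Lemma window_exact Y X t s (z : nat -> 'cV[R]_(K t.+2)) :
    acyclic (kos (pencil Y X) n) -> acyclic (kos (pencil X Y) n) ->
    (0 < s)%N ->
    (forall i, (i.+1 < s)%N -> kos Y n t.+1 *m z i.+1 = kos X n t.+1 *m z i) ->
    (forall i, (i < s)%N -> kos Y n t *m (kos X n t.+1 *m z i) = 0) ->
  exists z' : nat -> 'cV[R]_(K t.+3),
    forall i, (i < s)%N -> z i = kos Y n t.+2 *m z' i.+1 - kos X n t.+2 *m z' i.
Proof.
move=> exYX exXY s_gt0 zcyc zminor.
have kk l u (v : 'cV[R]_(K u.+2)) : kos l n u *m (kos l n u.+1 *m v) = 0.
  by rewrite mulmxA kos_complex mul0mx.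
(* The term above the window is X z_(s-1), a cycle for both rows, so [p] bounds it over R[w]. *)
have [p [Np p0] [ep0 epS]] := @const_seq_exact Y X t _ exYX
  (zminor s.-1 ltac:(by rewrite prednK)) (kk _ _ _).
(* The term below is Y z_0; exchanging the rows replaces w by 1/w, and [q] bounds it there. *)
have [|q [Nq q0] [eq0 eqS]] := @const_seq_exact X Y t _ exXY _ (kk Y t (z 0%N)).
  by rewrite mulmxA kos_anticomm mulNmx -mulmxA zminor ?oppr0.
have {}epS j : kos Y n t.+1 *m p j.+1 = kos X n t.+1 *m p j.
  by apply/eqP; rewrite -subr_eq0 -epS.
have {}eqS j : kos Y n t.+1 *m q j = kos X n t.+1 *m q j.+1.
  by apply/esym/eqP; rewrite -subr_eq0 -eqS.
pose M := Nq.+1.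
pose T j := if (j < M)%N then q (Nq - j)%N else
            if (j < M + s)%N then z (j - M)%N else p (j - (M + s))%N.
have [|||T' _ [_ eT]] := @pencil_exact Y X t.+1 T exYX.
- exists (M + s + Np)%N => j le_j; rewrite /T.
  by rewrite !ifN ?p0 //; move: le_j; lia.
- by rewrite /T /= subn0 eqS q0 ?mulmx0.
- move=> j; rewrite /T.
  have [lt1|] := ltnP j.+1 M.
    rewrite ltnW // eqS; congr (_ *m q _); move: lt1; rewrite /M; lia.
  rewrite leq_eqVlt => /predU1P[[<-]|lt1].
    rewrite ltnSn -/M.
    rewrite ifT; last by move: s_gt0; rewrite /M; lia.
    by rewrite !subnn -eq0.
  rewrite [in RHS]ifN -?leqNgt //.
  have [lt2|] := ltnP j.+1 (M + s)%N.
    rewrite ifT; last by move: lt2; lia.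
    by rewrite subSn // zcyc //; move: lt1 lt2; lia.
  rewrite leq_eqVlt => /predU1P[ej|lt2].
    rewrite -ej subnn -ep0 ifT; last by move: ej; lia.
    by congr (_ *m z _); move: ej s_gt0; lia.
  by rewrite ifN -?leqNgt // subSn // epS.
(* z_i sits at index [Nq.+1 + i] of [T], whose equation involves [T'] at that index and at
   [Nq + i]. *)
exists (fun i => T' (Nq + i)%N) => i lt_i.
rewrite addnS -eT /T ltnNge leq_addr /= -addSn.
by rewrite ltn_add2l lt_i addKn.
Qed.

(** The gluing of [window_exact] with an empty window: g = Y p_0 = X q_0 makes [q] reversed followed
    by [p] a cycle. The composite of the two differentials sends basis vectors to 2x2 minors, up to
    sign. *)
Lemma minors_exact Y X (g : 'cV[R]_1) :
    acyclic (kos (pencil Y X) n) ->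
    in_ideal (pencil Y X) n (g 0 0)%:P -> in_ideal (pencil X Y) n (g 0 0)%:P ->
  exists z, g = kos Y n 0 *m (kos X n 1 *m z).
Proof.
move=> ex /const_seq_ideal[p [Np p0] [ep0 epS]] /const_seq_ideal[q [Nq q0] [eq0 eqS]].
have {}epS j : kos Y n 0 *m p j.+1 = kos X n 0 *m p j.
  by apply/eqP; rewrite -subr_eq0 -epS.
have {}eqS j : kos Y n 0 *m q j = kos X n 0 *m q j.+1.
  by apply/esym/eqP; rewrite -subr_eq0 -eqS.
pose T j := if (j <= Nq)%N then q (Nq - j)%N else p (j - Nq.+1)%N.
have [|||T' _ [_ eT]] := @pencil_exact Y X 0 T ex.
- exists (Nq.+1 + Np)%N => j le_j; rewrite /T.
  by rewrite !ifN ?p0 //; move: le_j; lia.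
- by rewrite /T /= subn0 eqS q0 ?mulmx0.
- move=> j; rewrite /T.
  have [lt1|] := ltnP j Nq.
    by rewrite ltnW // eqS; congr (_ *m q _); move: lt1; lia.
  rewrite leq_eqVlt => /predU1P[<-|lt1].
    by rewrite leqnn !subnn -ep0 -eq0.
  by rewrite leqNgt lt1 /= subSn // epS.
(* From p_0 = Y T'_(Nq+1) - X T'_Nq and Y Y = 0, applying Y leaves g = - Y X T'_Nq. *)
exists (- T' Nq).
have := eT Nq; rewrite /T ltnn subnn => ep.
by rewrite [LHS]ep0 ep mulmxBr mulmxA kos_complex mul0mx sub0r !mulmxN.
Qed.

End Pencil.

(** * Regularity of the two pencils of variables *)

Section Ideal.
Variables (S : comNzRingType) (l : nat -> S) (n : nat).

Lemma in_ideal0 : in_ideal l n 0.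
Proof. by exists (fun=> 0); rewrite big1 // => i _; rewrite mul0r. Qed.

Lemma in_idealD a b : in_ideal l n a -> in_ideal l n b -> in_ideal l n (a + b).
Proof.
move=> [c ->] [c' ->]; exists (fun i => c i + c' i).
by rewrite -big_split; apply: eq_bigr => i _; rewrite mulrDl.
Qed.

Lemma in_idealMl a b : in_ideal l n b -> in_ideal l n (a * b).
Proof.
move=> [c ->]; exists (fun i => a * c i).
by rewrite mulr_sumr; apply: eq_bigr => i _; rewrite mulrA.
Qed.

Lemma in_ideal_gen i : (i < n)%N -> in_ideal l n (l i).
Proof.
move=> lt_in; exists (fun j => (j == i)%:R).
rewrite (bigD1 (Ordinal lt_in)) //= eqxx mul1r big1 ?addr0 // => j ne_ji.
by rewrite -[(j : nat) == i]/(j == Ordinal lt_in) (negPf ne_ji) mul0r.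
Qed.

Lemma in_ideal_subM a a' b b' : in_ideal l n (a - a') -> in_ideal l n (b - b') ->
  in_ideal l n (a * b - a' * b').
Proof.
move=> Ia Ib; rewrite (_ : _ - _ = b * (a - a') + a' * (b - b')); last by ring.
by apply: in_idealD; apply: in_idealMl.
Qed.

End Ideal.

Lemma polyC_subX_neq0 (S : comNzRingType) (a : S) (q : {poly S}) :
  a != 0 -> a%:P - 'X * q != 0.
Proof.
apply: contraNneq => /(congr1 (fun p : {poly S} => p`_0)).
by rewrite coefB coefC coefXM coef0 subr0 => ->.
Qed.

Section Elimination.
Variables (k : fieldType) (n : nat).
Local Notation R := {mpoly k[n.+1]}.
Local Notation P := {poly {mpoly k[n.+1]}}.
Implicit Types (h l : nat -> P).

(** Beyond [n], [inord] defaults to index 0, hence the bounds on indices in later lemmas. *)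
Definition var (j : nat) : R := 'X_(inord j).

Lemma var_neq0 j : var j != 0.
Proof. by rewrite -msupp_eq0 msuppX. Qed.

Definition elim_coef h : R -> P :=
  mmap (polyC \o @mpolyC n.+1 k) (fun i : 'I_n.+1 => h i).

HB.instance Definition _ h := GRing.RMorphism.on (elim_coef h).

(** Substitution of [h j] for x_j in R[w], with w fixed. *)
Definition elim h : P -> P := horner_eval 'X \o map_poly (elim_coef h).

HB.instance Definition _ h := GRing.RMorphism.on (elim h).

Lemma elimX h : elim h 'X = 'X.
Proof. by rewrite /elim /= map_polyX horner_evalE hornerX. Qed.

Lemma elimC h (p : R) : elim h p%:P = elim_coef h p.
Proof. by rewrite /elim /= map_polyC horner_evalE hornerC. Qed.

Lemma elim_var h j : (j <= n)%N -> elim h (var j)%:P = h j.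
Proof. by move=> le_jn; rewrite elimC /elim_coef mmapX mmap1U inordK. Qed.

Lemma elim_coef_congr h l i (c : R) :
    (forall j, (j <= n)%N -> in_ideal l i ((var j)%:P - h j)) ->
  in_ideal l i (c%:P - elim_coef h c).
Proof.
move=> hl.
have eD (a b : R) : elim_coef h (a + b) = elim_coef h a + elim_coef h b by exact: rmorphD.
have eM (a b : R) : elim_coef h (a * b) = elim_coef h a * elim_coef h b by exact: rmorphM.
pose Q (a : R) := in_ideal l i (a%:P - elim_coef h a).
have Q1 (a b : R) : Q a -> Q b -> Q (a * b).
  by rewrite /Q polyCM eM; apply: in_ideal_subM.
have QC (a : k) : Q a%:MP.
  by rewrite /Q /elim_coef mmapC subrr; exact: in_ideal0.
elim/mpolyind: c => [|c m q _ _ IHq].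
  by rewrite polyC0 [elim_coef h 0]rmorph0 subrr; exact: in_ideal0.
rewrite -mul_mpolyC eD polyCD opprD addrACA.
apply: in_idealD; last exact: IHq.
apply/Q1; first exact: QC.
rewrite mpolyXE_id; elim/big_rec: _ => [|j a _ IH]; first exact: (QC 1).
apply/Q1; last exact: IH.
elim: (m j) => [|e IHe]; first exact: (QC 1).
rewrite exprS; apply/Q1; last exact: IHe.
have -> : 'X_j = var j by rewrite /var inord_val.
by rewrite /Q -elimC elim_var; [apply: hl|]; rewrite -ltnS.
Qed.

Lemma elim_congr h l i :
    (forall j, (j <= n)%N -> in_ideal l i ((var j)%:P - h j)) ->
  forall p, in_ideal l i (p - elim h p).
Proof.
move=> hl; elim/poly_ind => [|p c IHp]; first by rewrite rmorph0 subrr; exact: in_ideal0.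
rewrite rmorphD rmorphM /= elimX opprD addrACA; apply: in_idealD.
  by apply: in_ideal_subM; [exact: IHp | rewrite subrr; exact: in_ideal0].
by rewrite elimC; exact: elim_coef_congr.
Qed.

Lemma mulf_cancel0 (D : idomainType) (a b : D) : a * b = 0 -> a != 0 -> b = 0.
Proof. by move/eqP; rewrite mulf_eq0 => /predU1P[->|/eqP]; rewrite ?eqxx. Qed.

Lemma elim_kernel h l i g :
    (forall j, (j <= n)%N -> in_ideal l i ((var j)%:P - h j)) ->
  elim h g = 0 -> in_ideal l i g.
Proof. by move=> hl hg; rewrite -[g]subr0 -hg; apply: elim_congr. Qed.

Lemma elim_ideal0 h l i g :
  (forall j, (j < i)%N -> elim h (l j) = 0) -> in_ideal l i g -> elim h g = 0.
Proof.
move=> hl [c ->]; rewrite rmorph_sum big1 // => j _.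
by rewrite rmorphM /= hl // mulr0.
Qed.

(** The first two hypotheses make the ideal of the first [i] elements the kernel of [elim h]; the
    quotient embeds in a domain, where nonzero means regular. *)
Lemma elim_regular h l i g :
    (forall j, (j <= n)%N -> in_ideal l i ((var j)%:P - h j)) ->
    (forall j, (j < i)%N -> elim h (l j) = 0) -> elim h (l i) != 0 ->
  in_ideal l i (l i * g) -> in_ideal l i g.
Proof.
move=> hv hl hi /(elim_ideal0 hl).
have -> : elim h (l i * g) = elim h (l i) * elim h g by exact: rmorphM.
by move/(@mulf_cancel0 P)/(_ hi); apply: elim_kernel.
Qed.

Definition pencil_up := pencil (fun i => var i.+1) var.
Definition pencil_down := pencil var (fun i => var i.+1).

(** Normal forms modulo the first [i] members of the pencil: going up these eliminate x_1, ..., x_i,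
    going down x_0, ..., x_(i-1). *)
Definition pt_up i j : P := if (j <= i)%N then 'X^j * (var 0)%:P else (var j)%:P.
Definition pt_down i j : P :=
  if (j <= i)%N then 'X^(i - j) * (var i)%:P else (var j)%:P.

Lemma elim_pencil h Y X i : elim h (pencil Y X i) = elim_coef h (Y i) - 'X * elim_coef h (X i).
Proof. by rewrite /pencil rmorphB rmorphM /= elimX !elimC. Qed.

Lemma pt_up_congr i j : (i <= n)%N -> in_ideal pencil_up i ((var j)%:P - pt_up i j).
Proof.
move=> le_in; rewrite /pt_up; case: leqP => [|_]; last by rewrite subrr; exact: in_ideal0.
elim: j => [|j IHj] le_ji; first by rewrite mul1r subrr; exact: in_ideal0.
rewrite (_ : _ - _ = pencil_up j + 'X * ((var j)%:P - 'X^j * (var 0)%:P)).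
  by apply: in_idealD; [apply: in_ideal_gen | apply/in_idealMl/IHj/ltnW].
by rewrite /pencil_up /pencil exprS; ring.
Qed.

Lemma pt_down_congr i j : (i <= n)%N -> in_ideal pencil_down i ((var j)%:P - pt_down i j).
Proof.
move=> le_in; rewrite /pt_down; case: leqP => [le_ji|_]; last by rewrite subrr; exact: in_ideal0.
(* Descending induction from [i], since x_j is rewritten through x_(j+1). *)
have [e ->] : exists e, j = (i - e)%N by exists (i - j)%N; lia.
elim: e => [|e IHe]; first by rewrite subn0 subnn mul1r subrr; exact: in_ideal0.
have [le_ie|lt_ei] := leqP i e; first by rewrite (_ : i - e.+1 = i - e)%N //; lia.
rewrite (_ : _ - _ = pencil_down (i - e.+1) +
  'X * ((var (i - e))%:P - 'X^(i - (i - e)) * (var i)%:P)).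
  by apply: in_idealD; [apply: in_ideal_gen; lia | apply/in_idealMl].
rewrite /pencil_down /pencil (_ : i - e = (i - e.+1).+1)%N; last by lia.
rewrite (_ : i - (i - e.+1) = (i - (i - e.+1).+1).+1)%N; last by lia.
by rewrite exprS; ring.
Qed.

Lemma elim_up i j : (j < i <= n)%N -> elim (pt_up i) (pencil_up j) = 0.
Proof.
move=> /andP[lt_ji le_in]; rewrite /pencil_up elim_pencil -!elimC !elim_var; try lia.
by rewrite /pt_up lt_ji ltnW // exprS; ring.
Qed.

Lemma elim_down i j : (j < i <= n)%N -> elim (pt_down i) (pencil_down j) = 0.
Proof.
move=> /andP[lt_ji le_in]; rewrite /pencil_down elim_pencil -!elimC !elim_var; try lia.
by rewrite /pt_down lt_ji ltnW // -(subnSK lt_ji) exprS; ring.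
Qed.

(** After elimination, member [i] becomes x_(i+1) - w^(i+1) x_0, nonzero because its constant term
    in w is a variable. *)
Lemma pencil_up_acyclic : acyclic (kos pencil_up n).
Proof.
apply: kos_acyclic => i g lt_in; apply: (@elim_regular (pt_up i)) => [j _|j lt_ji|].
- exact/pt_up_congr/ltnW.
- by apply: elim_up; rewrite lt_ji ltnW.
rewrite /pencil_up elim_pencil -!elimC !elim_var ?(ltnW lt_in) // /pt_up ltnn leqnn.
exact: polyC_subX_neq0 (var_neq0 _).
Qed.

Lemma pencil_down_acyclic : acyclic (kos pencil_down n).
Proof.
apply: kos_acyclic => i g lt_in; apply: (@elim_regular (pt_down i)) => [j _|j lt_ji|].
- exact/pt_down_congr/ltnW.
- by apply: elim_down; rewrite lt_ji ltnW.
rewrite /pencil_down elim_pencil -!elimC !elim_var ?(ltnW lt_in) // /pt_down ltnn leqnn.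
rewrite subnn expr0 mul1r.
exact: polyC_subX_neq0 (var_neq0 _).
Qed.

End Elimination.

(** * The Eagon-Northcott complex *)

Lemma cone_minimal (S S' : comNzRingType) (h : {rmorphism S -> S'}) b f (d : diff S b) :
    h f = 0 -> (forall s, map_mx h (d s) = 0) ->
  forall s, map_mx h (cone_diff f d s) = 0.
Proof.
move=> hf hd [|s] /=.
  by rewrite map_row_mx map_scalar_mx /= hf raddf0 (hd 0%N) row_mx0.
by rewrite map_block_mx map_scalar_mx /= hf raddf0 map_mxN map_mx0 (hd s) (hd s.+1) oppr0 block_mx0.
Qed.

Lemma kos_minimal (S S' : comNzRingType) (h : {rmorphism S -> S'}) l n s :
  (forall i, (i < n)%N -> h (l i) = 0) -> map_mx h (kos l n s) = 0.
Proof.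
move=> hl; rewrite map_kos (@eq_kos _ _ (fun=> 0 * 0)) ?kosZ ?scale0r //.
by move=> i /hl /= ->; rewrite mul0r.
Qed.

Section EagonNorthcott.
Variables (R : comNzRingType) (n : nat) (Y X : nat -> R).

Local Notation K s := (rk (kos_rk n) s).

(** Rank in degree [s.+1]: one Koszul chain of degree [s.+2] for each of [s.+1] consecutive powers
    of w. *)
Definition en_rk (s : nat) : nat := (K s.+2 * s.+1)%N.

(** Columns are coefficients of powers of w. The pencil differential is kept at the inner powers
    only; its extreme coefficients, Y Z_0 at the bottom and - X Z_(s+1) at the top, are dropped. *)
Definition en_step s (Z : 'M[R]_(K s.+3, s.+2)) : 'M[R]_(K s.+2, s.+1) :=
  kos Y n s.+2 *m col' ord0 Z - kos X n s.+2 *m col' ord_max Z.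

Definition en_fun s : 'rV[R]_(en_rk s) -> 'rV[R]_(rk en_rk s) :=
  match s return 'rV_(en_rk s) -> 'rV_(rk en_rk s) with
  | 0 => fun u => (kos Y n 0 *m (kos X n 1 *m vec_mx u))^T
  | s'.+1 => fun u => mxvec (en_step (vec_mx u))
  end.

Lemma en_fun_mxvec s Z : @en_fun s.+1 (mxvec Z) = mxvec (en_step Z).
Proof.
have e : vec_mx (mxvec Z) = Z by exact: mxvecK.
by rewrite /= [X in en_step X]e.
Qed.

Lemma en_fun_linear s : linear (@en_fun s).
Proof.
case: s => [|s] a u v; rewrite /en_fun; first by rewrite !linearP.
rewrite !linearP.
suff -> (Z W : 'M_(K s.+3, s.+2)) : en_step (a *: Z + W) = a *: en_step Z + en_step W.
  by rewrite linearP.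
have colP j : col' j (a *: Z + W) = a *: col' j Z + col' j W by exact: linearP.
rewrite /en_step !colP !mulmxDr -!scalemxAr scalerBr opprD addrACA //.
Qed.

HB.instance Definition _ s :=
  GRing.isLinear.Build R 'rV[R]_(en_rk s) 'rV[R]_(rk en_rk s) _ (@en_fun s) (@en_fun_linear s).

Definition en_diff : diff R en_rk := fun s => (lin1_mx (@en_fun s))^T.

Lemma mul_en_diff s (v : 'cV_(en_rk s)) : en_diff s *m v = (en_fun v^T)^T.
Proof. by rewrite -[v in LHS]trmxK -trmx_mul mul_rV_lin1. Qed.

Definition nth_col p s (Z : 'M[R]_(p, s.+1)) i := col (inord i) Z.

Lemma nth_colP p s (Z Z' : 'M[R]_(p, s.+1)) :
  (forall i, (i < s.+1)%N -> nth_col Z i = nth_col Z' i) -> Z = Z'.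
Proof.
move=> e; apply/matrixP=> a j; have /colP/(_ a) := e j (ltn_ord j).
by rewrite !mxE !inord_val.
Qed.

Lemma nth_col_step s (Z : 'M_(K s.+3, s.+2)) i : (i < s.+1)%N ->
  nth_col (en_step Z) i =
    kos Y n s.+2 *m nth_col Z i.+1 - kos X n s.+2 *m nth_col Z i.
Proof.
move=> lt_is; rewrite /nth_col /en_step !colE mulmxBl -!mulmxA -!colE.
have -> : col (inord i) (col' ord0 Z) = col (inord i.+1) Z.
  apply/colP=> a; rewrite !mxE; congr (Z a _).
  by apply: val_inj; rewrite /= !inordK.
have -> // : col (inord i) (col' ord_max Z) = col (inord i) Z.
apply/colP=> a; rewrite !mxE; congr (Z a _).
by apply: val_inj; apply: etrans (lift_max _) _; rewrite /= !inordK // ltnW.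
Qed.

Lemma en_complex : is_complex en_diff.
Proof.
have kk l u (v : 'cV[R]_(K u.+2)) : kos l n u *m (kos l n u.+1 *m v) = 0.
  by rewrite mulmxA kos_complex mul0mx.
have ka l l' u (v : 'cV[R]_(K u.+2)) :
    kos l n u *m (kos l' n u.+1 *m v) = - (kos l' n u *m (kos l n u.+1 *m v)).
  by rewrite !mulmxA kos_anticomm mulNmx.
move=> s.
suff dd0 (v : 'cV_(rk en_rk s.+2)) : en_diff s *m (en_diff s.+1 *m v) = 0.
  by apply/matrixP=> i j; have /colP/(_ i) := dd0 (delta_mx j 0); rewrite mulmxA -colE !mxE.
rewrite !mul_en_diff trmxK; apply: trmx_inj; rewrite trmxK trmx0.
case: s v => [|s] v; rewrite /en_fun !mxvecK.
  set Z := vec_mx _; rewrite (_ : _ *m _ = 0) ?trmx0 //.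
  apply: nth_colP => -[|//] _; rewrite /nth_col !colE -!mulmxA -colE -/(nth_col _ _).
  by rewrite nth_col_step // !mulmxBr kk mulmx0 subr0 ka kk mulmx0 oppr0 mul0mx.
set Z := vec_mx _; rewrite (_ : en_step _ = 0) ?linear0 //.
apply: nth_colP => j lt_js; rewrite nth_col_step // !nth_col_step //; last exact: ltnW.
rewrite !mulmxBr !kk sub0r subr0 ka opprK subrr.
by rewrite /nth_col colE mul0mx.
Qed.

Lemma en_window s (Z : 'M_(K s.+2, s.+1)) :
    acyclic (kos (pencil Y X) n) -> acyclic (kos (pencil X Y) n) ->
    (forall i, (i.+1 < s.+1)%N ->
       kos Y n s.+1 *m nth_col Z i.+1 = kos X n s.+1 *m nth_col Z i) ->
    (forall i, (i < s.+1)%N -> kos Y n s *m (kos X n s.+1 *m nth_col Z i) = 0) ->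
  exists Z', Z = en_step Z'.
Proof.
move=> exYX exXY cyc minor.
have [z' ez'] := window_exact exYX exXY (ltn0Sn s) cyc minor.
exists (\matrix_(a < K s.+3, j < s.+2) z' j a 0); apply: nth_colP => i lt_is.
set Z' := \matrix_(a, j) _.
have eZ' j : (j < s.+2)%N -> nth_col Z' j = z' j.
  by move=> lt_js; apply/colP=> a; rewrite !mxE inordK.
by rewrite nth_col_step // !eZ' ?ez' // ltnW.
Qed.

Lemma en_acyclic :
    acyclic (kos (pencil Y X) n) -> acyclic (kos (pencil X Y) n) ->
  acyclic en_diff.
Proof.
move=> exYX exXY s v; rewrite mul_en_diff => ev.
have kk l u (w : 'cV[R]_(K u.+2)) : kos l n u *m (kos l n u.+1 *m w) = 0.
  by rewrite mulmxA kos_complex mul0mx.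
suff [Z' eZ'] : exists Z', vec_mx v^T = en_step Z'.
  exists (mxvec Z')^T; rewrite mul_en_diff trmxK en_fun_mxvec -eZ' vec_mxK trmxK //.
move/(congr1 trmx): ev; rewrite trmxK trmx0.
case: s v => [|s] v; rewrite /en_fun => ev.
  (* With a single column the cycle condition is vacuous, and [ev] is itself the minor condition. *)
  apply: en_window => // -[|//] _.
  move/(congr1 trmx): ev; rewrite trmxK trmx0.
  by rewrite /nth_col colE !mulmxA -[_ *m _ *m _]mulmxA => ->; rewrite mul0mx.
have {}ev : en_step (vec_mx v^T) = 0 by rewrite -[LHS]mxvecK ev linear0.
have cyc i : (i.+1 < s.+2)%N -> kos Y n s.+2 *m nth_col (vec_mx v^T) i.+1 =
                                kos X n s.+2 *m nth_col (vec_mx v^T) i.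
  move=> lt_is; apply/eqP; rewrite -subr_eq0 -nth_col_step // ev.
  by rewrite /nth_col colE mul0mx.
(* The last column has no successor: there YX is turned into - XY, and [cyc] is applied with the
   preceding column. *)
apply: en_window => // i; rewrite ltnS leq_eqVlt => /predU1P[->|lt_is].
  by rewrite mulmxA kos_anticomm mulNmx -mulmxA cyc // kk oppr0.
by rewrite -cyc // kk.
Qed.

Lemma en_image (g : 'cV[R]_1) :
    acyclic (kos (pencil Y X) n) ->
    in_ideal (pencil Y X) n (g 0 0)%:P -> in_ideal (pencil X Y) n (g 0 0)%:P ->
  exists a, g = en_diff 0 *m a.
Proof.
move=> ex gYX gXY; have [z ->] := minors_exact ex gYX gXY.
exists (mxvec z)^T; rewrite mul_en_diff trmxK /en_fun trmxK.
have e : vec_mx (mxvec z) = z by exact: mxvecK.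
by congr (_ *m (_ *m _)); exact: esym e.
Qed.

(** Under [h] the two rows become proportional, so the 2x2 minors vanish. *)
Lemma en_image_eval (S : comNzRingType) (h : {rmorphism R -> S}) c (a : 'cV_(en_rk 0)) :
    (forall i, (i < n)%N -> h (Y i) = c * h (X i)) ->
  h ((en_diff 0 *m a) 0 0) = 0.
Proof.
move=> hYX; rewrite mul_en_diff trmxK; set z := vec_mx _.
have : map_mx h (kos Y n 0 *m (kos X n 1 *m z)) = 0.
  rewrite mulmxA !map_mxM !map_kos (eq_kos 0%N hYX) kosZ -scalemxAl.
  by rewrite kos_complex scaler0 mul0mx.
by move/matrixP/(_ 0 0); rewrite !mxE.
Qed.

Lemma en_image_eval_sym (S : comNzRingType) (h : {rmorphism R -> S}) c (a : 'cV_(en_rk 0)) :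
    (forall i, (i < n)%N -> h (X i) = c * h (Y i)) ->
  h ((en_diff 0 *m a) 0 0) = 0.
Proof.
move=> hXY; rewrite mul_en_diff trmxK; set z := vec_mx _.
have : map_mx h (kos Y n 0 *m (kos X n 1 *m z)) = 0.
  rewrite mulmxA !map_mxM !map_kos (eq_kos 1%N hXY) kosZ -scalemxAr.
  by rewrite kos_complex scaler0 mul0mx.
by move/matrixP/(_ 0 0); rewrite !mxE.
Qed.

Lemma en_minimal (S : comNzRingType) (h : {rmorphism R -> S}) s :
    (forall i, (i < n)%N -> h (Y i) = 0) -> (forall i, (i < n)%N -> h (X i) = 0) ->
  map_mx h (en_diff s) = 0.
Proof.
move=> hY hX.
suff en0 u : map_mx h (@en_fun s u) = 0.
  by apply/matrixP=> i j; have /rowP/(_ i) := en0 (delta_mx 0 j); rewrite !mxE.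
case: s u => [|s] u; rewrite /en_fun.
  by rewrite -map_trmx map_mxM (kos_minimal 0%N hY) mul0mx trmx0.
by rewrite map_mxvec /en_step map_mxB !map_mxM !kos_minimal // !mul0mx subr0 linear0.
Qed.

End EagonNorthcott.

(** * Comparison of minimal resolutions *)

Section Comparison.
Variables (R : comNzRingType) (k : fieldType) (h : {rmorphism R -> k}) (I : R -> Prop).

Definition resolution b (e : 'rV[R]_(b 0%N)) (d : forall s, 'M[R]_(b s, b s.+1)) :=
  [/\ forall f : R, exists v : 'cV_(b 0%N), I (f - (e *m v) 0 0),
      forall v : 'cV_(b 0%N), I ((e *m v) 0 0) <-> exists w, v = d 0%N *m w &
      forall s (v : 'cV_(b s.+1)), d s *m v = 0 <-> exists w, v = d s.+1 *m w].

Hypothesis I0 : I 0.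
Hypothesis ID : forall a b, I a -> I b -> I (a + b).
Hypothesis IM : forall a b, I b -> I (a * b).

Lemma mx_of_cols (p q r : nat) (P : 'I_q -> 'cV[R]_p -> 'cV[R]_r -> Prop) (A : 'M[R]_(p, q)) :
    (forall j, exists w, P j (col j A) w) ->
  exists W : 'M[R]_(r, q), forall j, P j (col j A) (col j W).
Proof.
move=> /fin_all_exists[w Pw]; exists (\matrix_(i, j) w j i 0) => j.
by rewrite (_ : col j (\matrix_(_, _) _) = w j) //; apply/colP=> i; rewrite !mxE.
Qed.

Lemma mx_factor p q r (D : 'M[R]_(p, r)) (A : 'M[R]_(p, q)) :
  (forall v : 'cV_q, exists w, A *m v = D *m w) -> exists W, A = D *m W.
Proof.
move=> AD; have [|W eW] := @mx_of_cols p q r (fun _ u w => u = D *m w) A.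
  by move=> j; rewrite colE; apply: AD.
exists W; apply/matrixP=> i j; have /colP/(_ i) := eW j.
by rewrite [LHS]mxE => ->; rewrite !mxE; apply: eq_bigr => l _; rewrite mxE.
Qed.

Lemma resolution_factor b e d : @resolution b e d ->
  forall s q (A : 'M_(b s.+1, q)), d s *m A = 0 -> exists W, A = d s.+1 *m W.
Proof.
move=> [_ _ ex] s q A dA; apply: mx_factor => v.
by apply/ex; rewrite mulmxA dA mul0mx.
Qed.

Lemma resolution_factor0 b e d : @resolution b e d ->
  forall q (A : 'M_(b 0%N, q)), (forall v : 'cV_q, I ((e *m A *m v) 0 0)) ->
  exists W, A = d 0%N *m W.
Proof.
move=> [_ ex _] q A eA; apply: mx_factor => v.
by apply/ex; rewrite mulmxA.
Qed.

Lemma resolution_complex b e d : @resolution b e d -> forall s, d s *m d s.+1 = 0.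
Proof.
move=> [_ _ ex] s; apply/matrixP=> i j.
have /matrixP/(_ i 0) : d s *m (d s.+1 *m delta_mx j (0 : 'I_1)) = 0.
  by apply/ex; exists (delta_mx j 0).
by rewrite mulmxA -colE !mxE.
Qed.

Lemma resolution_aug b e d : @resolution b e d ->
  forall q (f : 'rV_q), exists A : 'M_(b 0%N, q), forall v : 'cV_q, I (((f - e *m A) *m v) 0 0).
Proof.
move=> [ex _ _] q f.
have [|A eA] := @mx_of_cols 1 q (b 0%N) (fun _ u w => I (u 0 0 - (e *m w) 0 0)) f.
  by move=> j; apply: ex.
exists A => v; rewrite mxE; elim/big_rec: _ => [//|j x _ Ix]; apply: ID => //.
rewrite mulrC; apply: IM; have := eA j.
by rewrite !mxE (eq_bigr (fun l => e 0 l * A l j)) // => l _; rewrite mxE.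
Qed.

(** Minimality of [d] makes the homotopy vanish under [h], so the identity of k^(b s) factors
    through k^(b' s). *)
Lemma minimal_rank_le b e d b' e' d' :
    @resolution b e d -> @resolution b' e' d' -> (forall s, map_mx h (d s) = 0) ->
  forall s, (b s <= b' s)%N.
Proof.
move=> res res' hd.
have dd := resolution_complex res; have dd' := resolution_complex res'.
(* [G] carries the homotopy of the degree below composed with the differential (0 at the bottom);
   [phi'] and [psi'] are the lifts to the next degree. *)
suff homotopy s : exists (phi : 'M_(b' s, b s)) (psi : 'M_(b s, b' s)) H G,
    [/\ psi *m phi = 1%:M + d s *m H + G, G *m d s = 0, map_mx h G = 0,
        exists phi', phi *m d s = d' s *m phi' & exists psi', psi *m d' s = d s *m psi'].
  move=> s; have [phi [psi [H [G [e1 _ hG _ _]]]]] := homotopy s.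
  have := congr1 (map_mx h) e1.
  rewrite !map_mxD !map_mxM hd mul0mx hG !addr0 map_mx1 => e2.
  rewrite -[leqLHS](mxrank1 k) -e2.
  by rewrite (leq_trans (mxrankM_maxl _ _)) // rank_leq_col.
elim: s => [|s [phi [psi [H [G [e1 Gd hG [phi' ephi] [psi' epsi]]]]]]].
  have [phi ephi] := resolution_aug res' e; have [psi epsi] := resolution_aug res e'.
  have Ie (v : 'cV_(b 1)) : I ((e *m (d 0%N *m v)) 0 0).
    by have [_ ex _] := res; apply/ex; exists v.
  have Ie' (v : 'cV_(b' 1)) : I ((e' *m (d' 0%N *m v)) 0 0).
    by have [_ ex _] := res'; apply/ex; exists v.
  have IN x : I x -> I (- x) by move/(IM (-1)); rewrite mulN1r.
  have [|H eH] := resolution_factor0 res (A := psi *m phi - 1%:M).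
    move=> v; rewrite mulmxBr mulmx1.
    (* Both augmentation defects [e - e' *m phi] and [e' - e *m psi] take values in [I]. *)
    rewrite (_ : _ *m v = - ((e - e' *m phi) *m v + (e' - e *m psi) *m (phi *m v))).
      by rewrite mxE; apply: IN; rewrite mxE; apply: ID.
    by rewrite !mulmxBl !mulmxA opprD !opprB [RHS]addrC subrKA.
  exists phi, psi, H, 0; split; rewrite ?mul0mx ?map_mx0 //.
  - by rewrite addr0 -eH addrC subrK.
  - apply: (resolution_factor0 res') => v.
    rewrite (_ : _ *m v = e *m (d 0%N *m v) - (e - e' *m phi) *m (d 0%N *m v)).
      by rewrite mxE; apply: ID; rewrite // mxE; apply: IN.
    by rewrite mulmxBl opprB addrC subrK !mulmxA.
  - apply: (resolution_factor0 res) => v.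
    rewrite (_ : _ *m v = e' *m (d' 0%N *m v) - (e' - e *m psi) *m (d' 0%N *m v)).
      by rewrite mxE; apply: ID; rewrite // mxE; apply: IN.
    by rewrite mulmxBl opprB addrC subrK !mulmxA.
(* [d s] sends this defect to (psi phi - 1 - d H) d = G d = 0. *)
have [|H' eH'] := resolution_factor res (A := psi' *m phi' - 1%:M - H *m d s).
  rewrite !mulmxBr mulmx1 !mulmxA -epsi -(mulmxA psi) -ephi mulmxA e1.
  by rewrite !mulmxDl mul1mx Gd addr0 -addrA -opprD subrr.
exists phi', psi', H', (H *m d s); split.
- by rewrite -eH' -addrA subrK addrC subrK.
- by rewrite -mulmxA dd mulmx0.
- by rewrite map_mxM hd mulmx0.
- by apply: (resolution_factor res'); rewrite mulmxA -ephi -mulmxA dd mulmx0.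
- by apply: (resolution_factor res); rewrite mulmxA -epsi -mulmxA dd' mulmx0.
Qed.

End Comparison.

(** * The toric ideal *)

Lemma cone_image (S : comNzRingType) b f (d : diff S b) (v : 'cV[S]_1) :
  (exists w, v = cone_diff f d 0 *m w) <->
  (exists q u, v - (q * f)%:M = d 0%N *m u).
Proof.
split=> [[w ->]|[q [u eu]]]; last first.
  by exists (col_mx u q%:M); rewrite /= mul_row_col -eu -scalar_mxM mulrC subrK.
exists (dsubmx w 0 0), (usubmx w).
have -> : (dsubmx w 0 0 * f)%:M = f *: dsubmx w.
  by rewrite mulrC -scale_scalar_mx -mx11_scalar.
rewrite /= -{1}[w]vsubmxK mul_row_col mul_scalar_mx; exact: addrK.
Qed.

Section ToricIdeal.
Variables (k : fieldType) (n a delta : nat) (m : nat -> nat).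
Hypotheses (n_gt0 : (0 < n)%N) (a_gt0 : (0 < a)%N) (delta_gt0 : (0 < delta)%N).
Hypothesis mE : forall i, (i <= n)%N -> m i = (a * n + i * delta)%N.
Hypothesis co_m0 : coprime (a * n) delta.

Local Notation R := {mpoly k[n.+1]}.
Local Notation x := (@var k n).
Local Notation Y := (fun i => x i.+1).
Local Notation P := {poly R}.

(** The two charts of the rational normal curve, later instantiated by [elim_coef] at [pt_up] and
    [pt_down]. *)
Variables up down : {rmorphism R -> P}.
Hypothesis up_var : forall i, (i <= n)%N -> up (x i) = 'X^i * (x 0)%:P.
Hypothesis down_var : forall i, (i <= n)%N -> down (x i) = 'X^(n - i) * (x n)%:P.
Hypothesis up_kernel : forall g, up g = 0 -> in_ideal (pencil_up k n) n g%:P.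
Hypothesis down_kernel : forall g, down g = 0 -> in_ideal (pencil_down k n) n g%:P.

(** This is J: [in_scrollP] identifies it with the ideal of minors. *)
Definition in_scroll (g : R) := up g = 0 /\ down g = 0.

Lemma in_scrollP (g : 'cV[R]_1) :
  in_scroll (g 0 0) <-> exists w, g = en_diff n Y x 0 *m w.
Proof.
split=> [[gu gd]|[w ->]].
  apply: en_image; first exact: pencil_up_acyclic.
    exact: up_kernel.
  exact: down_kernel.
split.
  apply: (@en_image_eval _ n Y x _ up 'X) => i lt_in.
  by rewrite !up_var ?(ltnW lt_in) // exprS mulrA.
apply: (@en_image_eval_sym _ n Y x _ down 'X) => i lt_in.
by rewrite !down_var ?(ltnW lt_in) // -(subnSK lt_in) exprS mulrA.
Qed.

Definition binom : R := x n ^+ a - x 0 ^+ (a + delta).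

Lemma up_binom : up binom != 0.
Proof.
rewrite /binom rmorphB !rmorphXn.
rewrite !up_var // expr0 mul1r -oppr_eq0 opprB exprMn -exprM.
(* As n a > 0, a factor ['X] splits off the first monomial, and x_0^(a + delta) survives at w =
   0. *)
rewrite -[(n * a)%N]prednK ?muln_gt0 ?n_gt0 // exprS -mulrA -polyC_exp.
by apply: polyC_subX_neq0; rewrite expf_neq0 // var_neq0.
Qed.

Lemma down_binom : down binom != 0.
Proof.
rewrite /binom rmorphB !rmorphXn.
rewrite !down_var // subn0 subnn expr0 mul1r exprMn -exprM.
rewrite -[(n * (a + delta))%N]prednK ?muln_gt0 ?n_gt0 ?addn_gt0 ?a_gt0 // exprS -mulrA -polyC_exp.
by apply: polyC_subX_neq0; rewrite expf_neq0 // var_neq0.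
Qed.

Lemma scroll_regular g : in_scroll (binom * g) -> in_scroll g.
Proof.
rewrite /in_scroll !rmorphM => -[gu gd]; split.
  exact: mulf_cancel0 gu up_binom.
exact: mulf_cancel0 gd down_binom.
Qed.

Lemma in_scrollD p q : in_scroll p -> in_scroll q -> in_scroll (p + q).
Proof.
by move=> [p1 p2] [q1 q2]; rewrite /in_scroll !rmorphD p1 p2 q1 q2 !addr0.
Qed.

Lemma in_scrollM p q : in_scroll q -> in_scroll (p * q).
Proof.
by move=> [q1 q2]; rewrite /in_scroll !rmorphM q1 q2 !mulr0.
Qed.

Lemma in_scroll0 : in_scroll 0.
Proof. by split; exact: rmorph0. Qed.

Definition in_sum (g : R) := exists q, in_scroll (g - q * binom).

Lemma in_sum0 : in_sum 0.
Proof. by exists 0; rewrite mul0r subr0; exact: in_scroll0. Qed.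

Lemma in_sumD p q : in_sum p -> in_sum q -> in_sum (p + q).
Proof.
move=> [u pu] [v qv]; exists (u + v).
by rewrite mulrDl opprD addrACA; apply: in_scrollD.
Qed.

Lemma in_sumM p q : in_sum q -> in_sum (p * q).
Proof.
move=> [v vq]; exists (p * v).
by rewrite -mulrA -mulrBr; apply: in_scrollM.
Qed.

(** * Monomials: degree, weight and t-degree *)

Definition weight (e : 'X_{1..n.+1}) : nat := (\sum_(i < n.+1) i * e i)%N.

Lemma weightD e e' : weight (e + e')%MM = (weight e + weight e')%N.
Proof. by rewrite -big_split; apply: eq_bigr => i _; rewrite mnmDE mulnDr. Qed.

Lemma weightU i : weight U_(i)%MM = i.
Proof.
rewrite /weight (bigD1 i) //= mnm1E eqxx muln1 big1 ?addn0 // => j ne_ji.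
by rewrite mnm1E eq_sym (negPf ne_ji) muln0.
Qed.

Lemma weightMn e q : weight (e *+ q)%MM = (weight e * q)%N.
Proof.
by rewrite /weight big_distrl; apply: eq_bigr => i _; rewrite mulmnE mulnA.
Qed.

Lemma weight_le e : (weight e <= n * mdeg e)%N.
Proof.
rewrite mdegE big_distrr; apply: leq_sum => i _.
by rewrite leq_mul2r -ltnS ltn_ord orbT.
Qed.

(** Greedy choice: take x_n while the weight exceeds [n], then one variable x_w and powers of
    x_0. *)
Lemma mon_of_bidegree D w : (w <= n * D)%N -> exists e, mdeg e = D /\ weight e = w.
Proof.
elim: D w => [|D IHD] w.
  rewrite muln0 leqn0 => /eqP->; exists 0%MM.
  by rewrite mdeg0 /weight big1 // => i _; rewrite mnm0E muln0.
move=> le_w; have [le_wn|lt_nw] := leqP w n.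
  exists (U_(inord w) + U_(ord0) *+ D)%MM.
  by rewrite mdegD mdegMn !mdeg1 weightD weightMn !weightU inordK // mul1n mul0n addn0.
have [|e [eD ew]] := IHD (w - n)%N; first by move: le_w; rewrite mulnS; lia.
exists (U_(ord_max) + e)%MM.
by rewrite mdegD mdeg1 weightD weightU eD ew /= subnKC // ltnW.
Qed.

Lemma X_var (i : 'I_n.+1) : 'X_i = x i :> R.
Proof. by rewrite /var inord_val. Qed.

Lemma up_mon e : up 'X_[e] = 'X^(weight e) * (x 0)%:P ^+ mdeg e.
Proof.
rewrite mpolyXE_id rmorph_prod mdegE /weight -!prodrXr -big_split.
apply: eq_bigr => i _; rewrite rmorphXn /= X_var up_var -1?ltnS // exprMn -exprM //.
Qed.

Lemma down_mon e : down 'X_[e] = 'X^(n * mdeg e - weight e) * (x n)%:P ^+ mdeg e.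
Proof.
have -> : (n * mdeg e - weight e = \sum_(i < n.+1) (n - i) * e i)%N.
  rewrite mdegE big_distrr /weight -sumnB => [|i _]; last first.
    by rewrite leq_mul2r -ltnS ltn_ord orbT.
  by apply: eq_bigr => i _; rewrite mulnBl.
rewrite mpolyXE_id rmorph_prod mdegE -!prodrXr -big_split.
by apply: eq_bigr => i _; rewrite rmorphXn /= X_var down_var -1?ltnS // exprMn -exprM.
Qed.

Lemma in_scroll_mon e e' : mdeg e = mdeg e' -> weight e = weight e' ->
  in_scroll ('X_[e] - 'X_[e']).
Proof.
move=> eD ew.
split; first by rewrite rmorphB /= !up_mon eD ew subrr.
by rewrite rmorphB /= !down_mon eD ew subrr.
Qed.

Lemma in_sum_scroll g : in_scroll g -> in_sum g.
Proof. by exists 0; rewrite mul0r subr0. Qed.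

Definition tdeg e := (mdeg e * (a * n) + weight e * delta)%N.

(** By coprimality, equal t-degrees force the weights to differ by a n q and the degrees by delta q.
    Replacing x_n^a by x_0^(a + delta) q times bridges this gap, and monomials of equal degree and
    weight agree modulo J. *)
Lemma in_sum_mon_le e e' : (weight e <= weight e')%N -> tdeg e = tdeg e' ->
  in_sum ('X_[e] - 'X_[e']).
Proof.
rewrite /tdeg => le_w eT.
have [q eq] : exists q, weight e' = (weight e + a * n * q)%N.
  have /dvdnP[q eq] : (a * n %| weight e' - weight e)%N.
    rewrite -(Gauss_dvdl _ co_m0) mulnBl.
    apply/dvdnP; exists (mdeg e - mdeg e')%N; rewrite mulnBl.
    by move: eT le_w; clear; nia.
  by exists q; rewrite mulnC -eq subnKC.
have eD : mdeg e = (mdeg e' + delta * q)%N.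
  have an_gt0 : (0 < a * n)%N by rewrite muln_gt0 a_gt0.
  apply/eqP; rewrite -(eqn_pmul2r an_gt0); apply/eqP.
  by move: eT; rewrite eq; clear; nia.
(* The bound on weights leaves room for x_n^(a q) in the bidegree of [e'], with a cofactor [v] of
   the same weight as [e]. *)
have le_q : (weight e + n * (a * q) <= n * mdeg e')%N.
  by rewrite mulnA (mulnC n a) -eq weight_le.
have le_aq : (a * q <= mdeg e')%N.
  by rewrite -(leq_pmul2l n_gt0); apply: leq_trans le_q; rewrite leq_addl.
have [|v [vD vw]] := @mon_of_bidegree (mdeg e' - a * q) (weight e).
  by rewrite mulnBr leq_subRL ?leq_mul2l ?le_aq ?orbT // addnC.
(* [p] has the degree and weight of [e'], [p0] those of [e]. *)
pose p := (U_(ord_max) *+ (a * q) + v)%MM; pose p0 := (U_(ord0) *+ ((a + delta) * q) + v)%MM.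
rewrite (_ : _ - _ = ('X_[e] - 'X_[p0]) + (('X_[p0] - 'X_[p]) + ('X_[p] - 'X_[e']))); last first.
  by rewrite addrA subrKA subrKA.
apply: in_sumD.
  apply/in_sum_scroll/in_scroll_mon.
    by rewrite /p0 mdegD mdegMn mdeg1 vD eD; move: le_aq; clear; nia.
  by rewrite /p0 weightD weightMn weightU vw mul0n.
apply: in_sumD; last first.
  apply/in_sum_scroll/in_scroll_mon.
    by rewrite /p mdegD mdegMn mdeg1 vD mul1n subnKC.
  by rewrite /p weightD weightMn weightU vw eq /=; move: n; clear; nia.
rewrite /p /p0 !mpolyXD -mulrBl.
have -> : 'X_[U_(ord0) *+ ((a + delta) * q)] = (x 0 ^+ (a + delta)) ^+ q.
  rewrite -exprM mpolyXn; congr ('X_[U_(_) *+ _]).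
  by apply: val_inj; rewrite /= inordK.
have -> : 'X_[U_(ord_max) *+ (a * q)] = (x n ^+ a) ^+ q.
  rewrite -exprM mpolyXn; congr ('X_[U_(_) *+ _]).
  by apply: val_inj; rewrite /= inordK.
rewrite subrXX; set S := \sum_(_ < _) _.
rewrite (_ : _ * S * _ = - (S * 'X_[v]) * binom); last by rewrite /binom; ring.
apply: in_sumM.
exists 1; rewrite mul1r subrr; exact: in_scroll0.
Qed.

Lemma in_sum_mon e e' : tdeg e = tdeg e' -> in_sum ('X_[e] - 'X_[e']).
Proof.
move=> eT; have [le_w|/ltnW le_w] := leqP (weight e) (weight e').
  exact: in_sum_mon_le.
by rewrite -opprB -mulN1r; apply/in_sumM/in_sum_mon_le.
Qed.

(** * Evaluation in k[t] *)

Definition toric_eval : R -> {poly k} :=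
  mmap (@polyC k) (fun i : 'I_n.+1 => 'X^(m i)).

HB.instance Definition _ := GRing.RMorphism.on toric_eval.

Lemma toric_eval_mon e : toric_eval 'X_[e] = 'X^(tdeg e).
Proof.
rewrite /toric_eval mmapX /mmap1 /tdeg mdegE /weight !big_distrl -big_split -prodrXr.
apply: eq_bigr => i _; rewrite -exprM mE -1?ltnS //; congr ('X^_) => /=; ring.
Qed.

Lemma toric_eval_var i : (i <= n)%N -> toric_eval (x i) = 'X^(m i).
Proof. by move=> le_in; rewrite /toric_eval mmapX mmap1U inordK. Qed.

(** After the substitution, the row [Y] is t^delta times the row of the x_i. *)
Lemma toric_eval_scroll g : in_scroll g -> toric_eval g = 0.
Proof.
move=> gJ; have [] := in_scrollP (const_mx g); rewrite mxE => /(_ gJ)[w ew] _.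
have -> : g = (en_diff n Y x 0%N *m w) 0 0 by rewrite -ew mxE.
apply: (@en_image_eval _ n Y x _ (toric_eval : {rmorphism _ -> _}) 'X^delta).
move=> i lt_in; rewrite /= !toric_eval_var ?(ltnW lt_in) // -exprD; congr ('X^_).
by rewrite !mE ?(ltnW lt_in) // mulSn addnCA.
Qed.

Lemma toric_eval_binom : toric_eval binom = 0.
Proof.
rewrite /binom rmorphB !rmorphXn /= !toric_eval_var // -!exprM !mE //.
apply/eqP; rewrite subr_eq0; apply/eqP; congr ('X^_).
by rewrite mul0n addn0; ring.
Qed.

Lemma toric_eval_sum g : in_sum g -> toric_eval g = 0.
Proof.
move=> [q /toric_eval_scroll]; rewrite rmorphB rmorphM /= toric_eval_binom mulr0.
by rewrite subr0.
Qed.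

(* Modulo [in_sum], each monomial can be replaced by the chosen representative of
   its t-degree; after this [g] depends only on its image in k[t]. *)
Lemma in_sum_of_toric g : toric_eval g = 0 -> in_sum g.
Proof.
move=> g0; pose s := msupp g.
(* The default [0%MM] occurs only for [D] absent from the support, where the image of [g] has
   coefficient 0. *)
pose rep D := nth 0%MM s (find (fun e => tdeg e == D) s).
have repP e : e \in s -> tdeg (rep (tdeg e)) = tdeg e.
  by move=> es; apply/eqP/(@nth_find _ _ (fun f => tdeg f == tdeg e)); apply/hasP; exists e.
pose N := \sum_(e <- s) g@_e *: 'X_[rep (tdeg e)] : R.
have N0 : N = 0.
  pose B := (\max_(e <- s) tdeg e).+1.
  have lt_B e : e \in s -> (tdeg e < B)%N by move=> es; rewrite ltnS leq_bigmax_seq.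
  have evalE : toric_eval g = \sum_(e <- s) g@_e *: 'X^(tdeg e).
    rewrite [in LHS](mpolyE g) rmorph_sum; apply: eq_bigr => e _.
    by rewrite -mul_mpolyC rmorphM /= toric_eval_mon /toric_eval mmapC mul_polyC.
  (* Grouping by t-degree turns the coefficients of [g] into those of its image, which vanish. *)
  transitivity (\sum_(j < B) (toric_eval g)`_j *: 'X_[rep j] : R); last first.
    by rewrite big1 // => j _; rewrite g0 coef0 scale0r.
  rewrite evalE; under [RHS]eq_bigr => j _ do rewrite coef_sum scaler_suml.
  rewrite exchange_big /N !big_seq; apply: eq_bigr => e /lt_B lt_eB /=.
  rewrite (bigD1 (Ordinal lt_eB)) //= big1 => [|j ne_j].
    by rewrite addr0 coefZ coefXn eqxx mulr1.
  rewrite coefZ coefXn (_ : (j : nat) == tdeg e = false) ?mulr0 ?scale0r //.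
  by apply: contraNF ne_j => /eqP ej; apply/eqP/val_inj.
rewrite -[g]subr0 -N0 [X in X - _](mpolyE g) -sumrB big_seq.
elim/big_rec: _ => [|e p es IHp]; first exact: in_sum0.
apply: in_sumD => //; rewrite -scalerBr -mul_mpolyC; apply: in_sumM.
by apply: in_sum_mon; rewrite repP.
Qed.

Lemma toric_resolution :
  resolution (@in_toric_ideal k n m) (b := rk (cone_rk (en_rk n))) 1%:M
    (cone_diff binom (en_diff n Y x)).
Proof.
have toricP g : in_toric_ideal m g <-> in_sum g.
  by split; [exact: in_sum_of_toric | exact: toric_eval_sum].
have exEN : acyclic (en_diff n Y x).
  by apply: en_acyclic; [exact: pencil_up_acyclic | exact: pencil_down_acyclic].
have cxEN := @en_complex _ n Y x.
split=> [f|v|s v].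
- exists f%:M; rewrite mul1mx mxE mulr1n subrr; apply/toricP; exact: in_sum0.
- rewrite mul1mx; apply: iff_trans (toricP _) _; apply: iff_trans (iff_sym (cone_image _ _ _)).
  have scrollP q : in_scroll (v 0 0 - q * binom) <->
      exists u, v - (q * binom)%:M = en_diff n Y x 0 *m u.
    by rewrite -in_scrollP !mxE mulr1n.
  by split=> -[q /scrollP qJ]; exists q.
split=> [|[w ->]].
  apply: cone_acyclic exEN _ s v => g w e.
  have [] := in_scrollP g; move=> H _; apply: H.
  apply: scroll_regular; have [_] := in_scrollP (binom *: g); rewrite mxE; apply.
  by exists w.
by rewrite mulmxA (cone_complex binom cxEN) mul0mx.
Qed.

End ToricIdeal.

(** * The minimal resolution *)

Lemma arithmetic_seq_params n m : (2 <= n)%N -> arithmetic_seq n m -> (m 0 = 0 %[mod n])%N ->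
  exists a delta, [/\ (0 < a)%N, (0 < delta)%N, coprime (a * n) delta &
    forall i, (i <= n)%N -> m i = (a * n + i * delta)%N].
Proof.
move=> n_ge2 [gcd1 m0_gt0 m_incr [d dE] _] /eqP; rewrite mod0n => /dvdnP[a ea].
have [delta ed] : exists delta : nat, d = delta.
  have := dE 1%N (ltnW n_ge2); have := m_incr 0%N (ltnW n_ge2); rewrite mul1r.
  (* A negative difference would contradict m_0 < m_1. *)
  case: (d) => p; [by exists p | rewrite NegzE => lt01 m1E].
  have [m0E] : Posz (m 1%N + p.+1) = Posz (m 0%N) by rewrite PoszD m1E subrK.
  by move: lt01; rewrite -m0E ltnNge leq_addr.
have mE i : (i <= n)%N -> m i = (a * n + i * delta)%N.
  by move=> /dE; rewrite ed ea; lia.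
exists a, delta; split=> //.
- by move: m0_gt0; rewrite ea muln_gt0 => /andP[].
- have := m_incr 0%N (ltnW n_ge2); rewrite !mE //; last exact: ltnW.
  by rewrite mul0n mul1n ltn_add2l.
(* A common divisor of a n and delta divides every m_i, hence their gcd 1. *)
rewrite /coprime -dvdn1 -gcd1; apply/dvdn_biggcdP => i _.
rewrite mE -1?ltnS // dvdn_add ?dvdn_gcdl // dvdn_mull // dvdn_gcdr //.
Qed.

Lemma min_free_resolutionP (k : fieldType) (n : nat) m b (e : 'rV[{mpoly k[n.+1]}]_(b 0%N)) d :
  min_free_resolution m e d <->
  resolution (@in_toric_ideal k n m) e d /\ forall s, map_mx (mcoeff 0%MM) (d s) = 0.
Proof.
split=> [[r1 r2 r3 r4]|[[r1 r2 r3] r4]]; split=> //.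
  by move=> s; apply/matrixP=> i j; rewrite !mxE r4.
by move=> s i j; have /matrixP/(_ i j) := r4 s; rewrite !mxE.
Qed.

Lemma toric_min_resolution (k : fieldType) (n : nat) (m : nat -> nat) :
  (2 <= n)%N -> arithmetic_seq n m -> (m 0 = 0 %[mod n])%N ->
  exists (e : 'rV[{mpoly k[n.+1]}]_(rk (cone_rk (en_rk n)) 0))
         (d : diff {mpoly k[n.+1]} (cone_rk (en_rk n))),
    min_free_resolution m e d.
Proof.
move=> n_ge2 m_arith m0; have n_gt0 := ltnW n_ge2.
have [a [delta [a_gt0 delta_gt0 co mE]]] := arithmetic_seq_params n_ge2 m_arith m0.
have upE i : (i <= n)%N -> elim_coef (pt_up k n n) (var k n i) = 'X^i * (var k n 0)%:P.
  by move=> le_in; rewrite -elimC elim_var // /pt_up le_in.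
have downE i : (i <= n)%N ->
    elim_coef (pt_down k n n) (var k n i) = 'X^(n - i) * (var k n n)%:P.
  by move=> le_in; rewrite -elimC elim_var // /pt_down le_in.
exists 1%:M, (cone_diff (binom k n a delta) (en_diff n (fun i => var k n i.+1) (var k n))).
apply/min_free_resolutionP; split.
  apply: (@toric_resolution k n a delta m n_gt0 a_gt0 delta_gt0 mE co
           (elim_coef (pt_up k n n)) (elim_coef (pt_down k n n))).
  - exact: upE.
  - exact: downE.
  - move=> g g0; apply: (@elim_kernel k n (pt_up k n n) (pencil_up k n)).
      by move=> j _; exact: pt_up_congr.
    by rewrite elimC; exact: g0.
  move=> g g0; apply: (@elim_kernel k n (pt_down k n n) (pencil_down k n)).
    by move=> j _; exact: pt_down_congr.
  by rewrite elimC; exact: g0.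
have var0 i : (var k n i)@_0%MM = 0 by rewrite /var mcoeffX mnm1_eq0.
apply: cone_minimal => [|s]; last by apply: en_minimal => i _; exact: var0.
(* Both exponents are positive, so f has zero constant term. *)
rewrite /binom rmorphB !rmorphXn /= !var0 !expr0n addn_eq0 !gtn_eqF //.
by rewrite subrr.
Qed.

Lemma betti_toric n : [/\ rk (cone_rk (en_rk n)) 0 = 1%N,
  rk (cone_rk (en_rk n)) 1 = (1 + 'C(n, 2))%N &
  forall s, (2 <= s)%N ->
    rk (cone_rk (en_rk n)) s = ((s - 1) * 'C(n, s) + s * 'C(n, s.+1))%N].
Proof.
split=> [//||[|[|s]] // _].
  by rewrite -[LHS]/(en_rk n 0 + 1)%N /en_rk rk_kos muln1 addnC.
by rewrite -[LHS]/(en_rk n s.+1 + en_rk n s)%N /en_rk !rk_kos subn1 /=; ring.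
Qed.

Lemma in_toric_ideal0 (k : fieldType) n m : @in_toric_ideal k n m 0.
Proof. exact: rmorph0. Qed.

Lemma in_toric_idealD (k : fieldType) n m p q :
  @in_toric_ideal k n m p -> in_toric_ideal m q -> in_toric_ideal m (p + q).
Proof. by rewrite /in_toric_ideal mmapD => -> ->; rewrite addr0. Qed.

Lemma in_toric_idealM (k : fieldType) n m p q :
  @in_toric_ideal k n m q -> in_toric_ideal m (p * q).
Proof. by rewrite /in_toric_ideal rmorphM /= => ->; rewrite mulr0. Qed.

Theorem theorem2p4 (k : fieldType) (n : nat) (m : nat -> nat) :
  (2 <= n)%N -> arithmetic_seq n m -> (m 0 = 0 %[mod n])%N ->
  (* existence of a minimal free resolution of length n of the given shape *)
  (exists (b : nat -> nat) (e : 'rV[Rpoly k n]_(b 0%N))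
          (d : forall s : nat, 'M[Rpoly k n]_(b s, b s.+1)),
      min_free_resolution m e d /\
      [/\ b 0%N = 1%N,
          b 1%N = (1 + 'C(n, 2))%N,
          (forall s, (2 <= s <= n)%N ->
             b s = ((s - 1) * 'C(n, s) + s * 'C(n, s.+1))%N)
        & (forall s, (n < s)%N -> b s = 0%N)]) /\
  (* the Betti numbers (ranks in any minimal free resolution) *)
  (forall (b : nat -> nat) (e : 'rV[Rpoly k n]_(b 0%N))
          (d : forall s : nat, 'M[Rpoly k n]_(b s, b s.+1)),
      min_free_resolution m e d ->
      [/\ b 0%N = 1%N,
          b 1%N = (1 + 'C(n, 2))%N
        & (forall s, (2 <= s <= n)%N ->
             b s = ((s - 1) * 'C(n, s) + s * 'C(n, s.+1))%N)]).
Proof.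
move=> n_ge2 m_arith m0.
have [e [d res]] := toric_min_resolution k n_ge2 m_arith m0.
have [b0 b1 bS] := betti_toric n.
split.
  exists (rk (cone_rk (en_rk n))), e, d; split=> //; split=> // s.
    by case/andP=> s_ge2 _; exact: bS.
  move=> lt_ns; rewrite bS; last exact: leq_trans n_ge2 (ltnW lt_ns).
  by rewrite !bin_small ?muln0 // ltnW.
move=> b e' d' res'.
have rank_eq s : b s = rk (cone_rk (en_rk n)) s.
  have [r min] := (min_free_resolutionP m e d).1 res.
  have [r' min'] := (min_free_resolutionP m e' d').1 res'.
  have I0 := @in_toric_ideal0 k n m; have ID := @in_toric_idealD k n m.
  have IM := @in_toric_idealM k n m.
  apply/eqP; rewrite eqn_leq (minimal_rank_le I0 ID IM r' r min').
  exact: (minimal_rank_le I0 ID IM r r' min).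
by rewrite !rank_eq; split=> // s /andP[s_ge2 _]; rewrite rank_eq; exact: bS.
Qed.
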